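(* Consider weighted fair share policies with both job arrivals and departures. For every $c \ge 1$ there exist a constant $\kappa>0$ and an integer $n_0$, depending only on $c$, such that for every $n\ge n_0$ and every deterministic online feasible $c$-approximate allocation policy $A$ (with respect to the weighted fair share policy) there is an instance with arrivals and departures, with $n$ arriving jobs in total, on which $A$ makes at least $\kappa\, n^{1+1/(4c+1)}$ disruptions in total.
   Context: Model. There is one unit of a single divisible resource. An instance is a sequence of sets of alive jobs $N^0, N^1, N^2,\dots$; jobs in $N^t\setminus N^{t-1}$ arrive at time $t$ and jobs in $N^{t-1}\setminus N^t$ depart at time $t$ (several jobs may arrive or depart at the same time). Each job $j$ has a weight $w_j>0$, revealed on its arrival. The weighted fair share policy gives job $j \in N^t$ the ideal fair share $I(j,t) = w_j / \sum_{k\in N^t} w_k$. An allocation policy $A$ determines, at each time $t$, an allocation $A(j,t)\ge 0$ for every $j\in N^t$; it is online, i.e. the allocations at time $t$ depend only on what has been revealed up to time $t$ (the total number $n$ of jobs is assumed known a priori). It is feasible if $\sum_{j\in N^t}A(j,t)\le 1$ for all $t$. For $c\ge 1$, $A$ is $c$-approximate if $A(j,t)\ge I(j,t)/c$ for all $t$ and all $j\in N^t$. A disruption of job $j$ at time $t$ is a change in its allocation: $j\in N^{t-1}\cap N^t$ and $A(j,t)\ne A(j,t-1)$. The number of disruptions is counted over all jobs and times. *)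

(* Defs.v *)
From mathcomp Require Import all_boot all_order all_algebra.
From mathcomp Require Import classical_sets boolp reals ereal topology.
From mathcomp Require Import normedtype sequences exp.

Set Implicit Arguments.
Unset Strict Implicit.
Unset Printing Implicit Defensive.

Import Order.TTheory GRing.Theory Num.Theory.
Local Open Scope ring_scope.

(* The jobs of an instance with n jobs in total are named by 'I_n, in an
   arbitrary order unrelated to arrival times.  Jobs alive at time 0 arrive at
   time 0.  Convexity of lifetimes says that a departed job never comes back,
   so that the n jobs account for exactly n arrivals. *)
Record instance (R : realType) (n : nat) := Instance {
  alive : nat -> {set 'I_n};
  weight : 'I_n -> R;
  weight_gt0 : forall j, 0 < weight j;
  alive_convex : forall j s t u, (s <= t <= u)%N ->
    j \in alive s -> j \in alive u -> j \in alive t;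
  all_arrive : forall j, exists t, j \in alive t
}.

Definition fair_share (R : realType) (n : nat) (I : instance R n)
    (j : 'I_n) (t : nat) : R :=
  weight I j / \sum_(k in alive I t) weight I k.

(* [A I j t] is meaningful only for j alive at time t: every condition below is
   restricted to such j.  A policy is a function of the whole instance, and
   [online] forbids it to look at the future.  It may depend on the total
   number n of jobs. *)
Definition policy (R : realType) (n : nat) := instance R n -> 'I_n -> nat -> R.

Definition same_history (R : realType) (n : nat) (I I' : instance R n)
    (t : nat) : Prop :=
  forall s, (s <= t)%N ->
    alive I s = alive I' s /\
    (forall j, j \in alive I s -> weight I j = weight I' j).

Definition online (R : realType) (n : nat) (A : policy R n) : Prop :=
  forall (I I' : instance R n) (t : nat), same_history I I' t ->
    forall j, j \in alive I t -> A I j t = A I' j t.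

Definition nonnegative (R : realType) (n : nat) (A : policy R n) : Prop :=
  forall (I : instance R n) (t : nat) (j : 'I_n),
    j \in alive I t -> 0 <= A I j t.

Definition feasible (R : realType) (n : nat) (A : policy R n) : Prop :=
  forall (I : instance R n) (t : nat), \sum_(j in alive I t) A I j t <= 1.

Definition approximate (R : realType) (n : nat) (c : R) (A : policy R n) :
    Prop :=
  forall (I : instance R n) (t : nat) (j : 'I_n),
    j \in alive I t -> fair_share I j t / c <= A I j t.

Definition disrupted (R : realType) (n : nat) (A : policy R n)
    (I : instance R n) (t : nat) : {set 'I_n} :=
  [set j in alive I t.-1 :&: alive I t | A I j t != A I j t.-1].

(* Instances are infinite sequences, so the total may be +oo. *)
Definition disruptions (R : realType) (n : nat) (A : policy R n)
    (I : instance R n) : \bar R :=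
  (\sum_(1 <= t <oo) (#|disrupted A I t|%:R : R)%:E)%E.

(* Main.v *)
(* One fixed instance defeats every policy.  Put K = floor (4c) and view times as
   the traversal of the r-ary tree of depth K: a node at depth i is a batch of
   r^(K-i) equal jobs, alive while its subtree is being visited, and the total
   weight of a batch doubles with each level.  When a batch is the deepest one
   alive it holds more than half of the weight, so its jobs get at least 1/(2c)
   in total.  At a leaf K+1 batches share the resource; as K+1 > 4c, at least half
   of the jobs of one of them, at depth i < K say, have been disrupted since the
   batch was last deepest, i.e. during the visit of its current child.  Charging
   these r^(K-i)/2 disruptions evenly to the r^(K-i-1) leaves below that child,
   every leaf is charged at least r/2, so r^(K+1)/2 disruptions occur, while
   (K+1) r^K jobs suffice. *)
Require Import Defs.
From mathcomp Require Import all_boot all_order all_algebra.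
From mathcomp Require Import classical_sets boolp reals ereal topology.
From mathcomp Require Import normedtype sequences exp.
From mathcomp Require Import zify ring lra.

Set Implicit Arguments.
Unset Strict Implicit.
Unset Printing Implicit Defensive.

Import Order.TTheory GRing.Theory Num.Theory.

(** * Counting and rounding with integer division *)

Lemma card_divn_eq (n s e : nat) : 0 < s -> e.+1 * s <= n ->
  #|[set k : 'I_n | k %/ s == e]| = s.
Proof.
move=> s0 hn.
have lt_n (a : 'I_s) : e * s + a < n by have := ltn_ord a; lia.
pose f a := Ordinal (lt_n a).
have f_inj : injective f by move=> a b /(congr1 val) /= /addnI /val_inj.
rewrite -[RHS](card_ord s) -(card_imset xpredT f_inj).
apply: eq_card => k; rewrite !inE; apply/eqP/imsetP => [ke|[a _ ->]] /=.
  by exists (Ordinal (ltn_pmod k s0)) => //; apply: val_inj; rewrite /= -ke -divn_eq.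
by rewrite divnMDl // divn_small ?addn0.
Qed.

(** Multiples of [s] are multiples of [d], so rounding [x] down to a multiple of [d] cannot cross
    one. *)
Lemma divn_floor_dvd x d s : 0 < d -> d %| s -> x %/ d * d %/ s = x %/ s.
Proof.
move=> d0 /dvdnP[q ->]; case: q => [|q]; first by rewrite mul0n !divn0.
by rewrite [q.+1 * d]mulnC !divnMA mulnK.
Qed.

(** * The schedule of the tree traversal *)

Section Tree.
Variables (n r K : nat).
Hypothesis r_gt0 : 0 < r.

(* Level i consists of the jobs numbered from i r^K up to (i+1) r^K.  It is cut
   into r^i batches; [batch i y] is the one alive at the leaves x with
   x / r^(K-i) = y. *)
Definition level (j : nat) : nat := j %/ r ^ K.

Definition batch_size (i : nat) : nat := r ^ (K - i).

Definition batch (i y : nat) : {set 'I_n} :=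
  [set k : 'I_n | k %/ batch_size i == i * r ^ i + y].

Definition period (i : nat) : nat := K.+1 * batch_size i.

(* Each leaf x is given the K+1 times from x(K+1) on, during which the batches
   that start at x enter one level at a time.  The jobs that are not needed for the
   tree arrive after the traversal. *)
Definition tree_alive_at (j t : nat) : bool :=
  let i := level j in
  if i <= K
  then (j %/ batch_size i == i * r ^ i + t %/ period i) && (i <= t %% period i)
  else r ^ K * K.+1 <= t.

Definition tree_alive (t : nat) : {set 'I_n} := [set j : 'I_n | tree_alive_at j t].

Lemma batch_size_gt0 i : 0 < batch_size i.
Proof. by rewrite expn_gt0 r_gt0. Qed.

Lemma period_gt0 i : 0 < period i.
Proof. by rewrite muln_gt0 batch_size_gt0. Qed.

Lemma batch_size_mul i : i <= K -> r ^ i * batch_size i = r ^ K.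
Proof. by move=> iK; rewrite -expnD subnKC. Qed.

Lemma batch_level i y (k : 'I_n) : i <= K -> y < r ^ i ->
  k \in batch i y -> level k = i.
Proof.
move=> iK yr; rewrite inE => /eqP kE.
rewrite /level -(batch_size_mul iK) mulnC divnMA kE divnMDl ?divn_small ?addn0 //.
by rewrite expn_gt0 r_gt0.
Qed.

Lemma card_batch i y : K.+1 * r ^ K <= n -> i <= K -> y < r ^ i -> #|batch i y| = batch_size i.
Proof.
move=> jobs_fit iK yr; apply: card_divn_eq; first exact: batch_size_gt0.
apply: leq_trans jobs_fit; rewrite -(batch_size_mul iK) mulnA leq_mul2r.
apply/orP; right; apply: (@leq_trans (i.+1 * r ^ i)); first by rewrite mulSn; lia.
by rewrite leq_mul2r ltnS iK orbT.
Qed.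

Lemma mem_tree_alive i t (k : 'I_n) : i <= K -> t %/ period i < r ^ i ->
  i <= t %% period i -> k \in batch i (t %/ period i) -> k \in tree_alive t.
Proof.
move=> iK tr it kb; rewrite inE /tree_alive_at (batch_level iK tr kb) iK it andbT.
by move: kb; rewrite inE.
Qed.

(** For a tree job the condition selects one interval of length [period i] and cuts off its first
    [i] times; the other jobs stay forever. *)
Lemma tree_alive_convex j s t u : s <= t <= u ->
  j \in tree_alive s -> j \in tree_alive u -> j \in tree_alive t.
Proof.
move=> /andP[st tu]; rewrite !inE /tree_alive_at; set i := level j.
case: (leqP i K) => iK; last by move=> h _; apply: leq_trans st.
move=> /andP[/eqP hs is_] /andP[/eqP hu iu].
have E : s %/ period i = u %/ period i by lia.
have Et : t %/ period i = s %/ period i.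
  by apply/eqP; rewrite eqn_leq (leq_div2r _ st) andbT E (leq_div2r _ tu).
rewrite Et hs eqxx /=; apply: leq_trans is_ _.
have := divn_eq s (period i); have := divn_eq t (period i); rewrite Et; lia.
Qed.

Lemma tree_all_arrive j : exists t, j \in tree_alive t.
Proof.
case: (leqP (level j) K) => iK; last first.
  by exists (r ^ K * K.+1); rewrite inE /tree_alive_at leqNgt iK /=.
set i := level j in iK.
(* Batches of level [i] are numbered from [i * r ^ i]; the subtraction gives the position of the
   batch, and the time is its first. *)
exists ((j %/ batch_size i - i * r ^ i) * period i + i).
have ip : (i < period i) by rewrite /period; have := batch_size_gt0 i; nia.
rewrite inE /tree_alive_at -/i iK divnMDl ?period_gt0 // modnMDl.
rewrite !(divn_small ip, modn_small ip).
rewrite addn0 leqnn andbT subnKC // leq_divRL ?batch_size_gt0 //.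
by rewrite -mulnA batch_size_mul // /i leq_trunc_div.
Qed.

(** * Leaf times and top times *)

Definition leaf_time (x : nat) : nat := x * K.+1 + K.

(* The last time, on the way to leaf x, at which no batch below level i is alive.
   For i = K it is [leaf_time x], as truncation gives [batch_size K.+1 = 1]. *)
Definition top_time (i x : nat) : nat :=
  x %/ batch_size i.+1 * batch_size i.+1 * K.+1 + i.

Lemma divn_period i x a : a <= K -> ((x * K.+1 + a) %/ period i = x %/ batch_size i).
Proof. by move=> aK; rewrite divnMA divnMDl // (@divn_small a) ?addn0 // ltnS. Qed.

Lemma modn_period i x a : a <= K ->
  ((x * K.+1 + a) %% period i = x %% batch_size i * K.+1 + a).
Proof.
move=> aK; have := divn_eq (x * K.+1 + a) (period i);
by rewrite divn_period // {1}(divn_eq x (batch_size i)) /period; lia.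
Qed.

Lemma leq_modn_period i x a : a <= K -> (a <= (x * K.+1 + a) %% period i).
Proof. by move=> aK; rewrite modn_period // leq_addl. Qed.

Lemma batch_size_dvd i j : i <= j -> (batch_size j %| batch_size i).
Proof. by move=> ij; apply: dvdn_exp2l; lia. Qed.

Lemma divn_batch_size_lt i x : i <= K -> x < r ^ K -> (x %/ batch_size i < r ^ i).
Proof. by move=> iK xr; rewrite ltn_divLR ?batch_size_gt0 // batch_size_mul. Qed.

Lemma top_time_divn i x : i <= K -> (top_time i x %/ period i = x %/ batch_size i).
Proof.
by move=> iK; rewrite divn_period // divn_floor_dvd ?batch_size_gt0 ?batch_size_dvd.
Qed.

Lemma leaf_alive i x : i <= K -> x < r ^ K ->
  batch i (x %/ batch_size i) \subset tree_alive (leaf_time x).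
Proof.
move=> iK xr; apply/fintype.subsetP => k kb; apply: (@mem_tree_alive i) => //.
- by rewrite divn_period // divn_batch_size_lt.
- by rewrite modn_period //; lia.
- by rewrite divn_period.
Qed.

Lemma top_alive i x : i <= K -> x < r ^ K ->
  batch i (x %/ batch_size i) \subset tree_alive (top_time i x).
Proof.
move=> iK xr; apply/fintype.subsetP => k kb; apply: (@mem_tree_alive i) => //.
- by rewrite top_time_divn // divn_batch_size_lt.
- exact: leq_modn_period.
- by rewrite top_time_divn.
Qed.

(** The leaf is rounded to a multiple of [batch_size i.+1], so modulo the period of a deeper level
    only [i] remains, too early for that level. *)
Lemma top_time_level i x (k : 'I_n) : i <= K -> x < r ^ K ->
  k \in tree_alive (top_time i x) ->
  (level k <= i) /\ k \in batch (level k) (top_time i x %/ period (level k)).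
Proof.
move=> iK xr; rewrite !inE /tree_alive_at; set l := level k.
case: (leqP l K) => lK.
  move=> /andP[-> lt]; split=> //; move: lt; rewrite leqNgt; apply: contraNT.
  rewrite -ltnNge => il; rewrite modn_period //.
  by rewrite (eqP (dvdn_mull _ (batch_size_dvd il))) mul0n.
move=> h; exfalso; have : (r ^ K * K.+1 <= x * K.+1 + i).
  apply: leq_trans h _; rewrite leq_add2r leq_mul2r leq_trunc_div orbT //.
nia.
Qed.

Lemma top_le_leaf i x : i <= K -> (top_time i x <= leaf_time x).
Proof. by move=> iK; rewrite leq_add // leq_mul2r leq_trunc_div orbT. Qed.

End Tree.

Local Open Scope ring_scope.

(** * From changed allocations to disruptions *)

Lemma change_disrupted (R : realType) (n : nat) (A : policy R n) (I : instance R n)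
    (j : 'I_n) (s t : nat) : (s <= t)%N ->
  j \in alive I s -> j \in alive I t -> A I j t != A I j s ->
  exists2 u, (s < u <= t)%N & j \in disrupted A I u.
Proof.
elim: t => [|t IH]; first by rewrite leqn0 => /eqP -> _ _; rewrite eqxx.
rewrite leq_eqVlt => /predU1P[-> _ _|]; first by rewrite eqxx.
rewrite ltnS => st js jt1 neq.
have jt : j \in alive I t by apply: (alive_convex (s := s) (u := t.+1)) => //; lia.
have [eq_t|neq_t] := eqVneq (A I j t.+1) (A I j t).
  have [|u /andP[su ut] ju] := IH st js jt; first by rewrite -eq_t.
  by exists u => //; lia.
by exists t.+1; [lia | rewrite !inE /= jt jt1].
Qed.

Lemma ge_partial_disruptions (R : realType) (n : nat) (A : policy R n)
    (I : instance R n) (N : nat) :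
  ((\sum_(0 <= t < N) #|disrupted A I t|%:R)%:E <= disruptions A I)%E.
Proof.
apply: (@le_trans _ _ (\sum_(1 <= t < N) (#|disrupted A I t|%:R)%:E)%E); last first.
  by apply: nneseries_lim_ge => t _ _; rewrite lee_fin.
rewrite sumEFin lee_fin; case: N => [|N]; first by rewrite !big_geq.
(* The predecessor [0.-1] is [0] itself, so time [0] contributes nothing. *)
have d0 : disrupted A I 0 = finset.set0 by apply/setP => k; rewrite !inE eqxx andbF.
by rewrite big_ltn // d0 cards0 add0r.
Qed.

(** * Weights, and forced changes at each leaf *)

Section TreeInstance.
Variables (R : realType) (n r K : nat).
Hypotheses (r_gt0 : (0 < r)%N) (jobs_fit : (K.+1 * r ^ K <= n)%N).

(* A batch of level i has total weight r^(K-i) (2r)^i = r^K 2^i. *)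
Definition tree_weight (j : 'I_n) : R := (2 * r)%:R ^+ level r K j.

Lemma tree_weight_gt0 j : 0 < tree_weight j.
Proof. by rewrite exprn_gt0 // ltr0n muln_gt0. Qed.

Definition tree_instance : instance R n :=
  Instance tree_weight_gt0 (tree_alive_convex r_gt0) (@tree_all_arrive n r K r_gt0).

(** The alive jobs lie in one batch per level [l <= i], of weight [r ^ K * 2 ^ l]; the geometric sum
    stays below twice its last term. *)
Lemma top_weight i x : (i <= K)%N -> (x < r ^ K)%N ->
  \sum_(k in tree_alive n r K (top_time r K i x)) tree_weight k
    <= 2 * (batch_size r K i)%:R * (2 * r)%:R ^+ i.
Proof.
move=> iK xr; set t := top_time r K i x.
pose b (l : nat) := batch n r K l (t %/ period r K l).
apply: (@le_trans _ _ (\sum_(k : 'I_n) \sum_(l < i.+1) (k \in b l)%:R * (2 * r)%:R ^+ l)).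
  rewrite big_mkcond ler_sum // => k _; case: ifP => [kt|_]; last first.
    by apply: sumr_ge0 => l _; rewrite mulr_ge0 // exprn_ge0.
  have [lk kb] := top_time_level r_gt0 iK xr kt.
  rewrite (bigD1 (Ordinal (lk : level r K k < i.+1)%N)) //= /b kb mul1r lerDl.
  by apply: sumr_ge0 => l _; rewrite mulr_ge0 // exprn_ge0.
rewrite exchange_big /=.
have -> : 2 * (batch_size r K i)%:R * (2 * r)%:R ^+ i = (r ^ K)%:R * 2 ^+ i.+1 :> R.
  by rewrite -(batch_size_mul r iK) !natrM !natrX exprMn exprS; ring.
have card_b (l : 'I_i.+1) : #|b l| = batch_size r K l.
  have lK : (l <= K)%N by have := ltn_ord l; lia.
  apply: card_batch => //; rewrite divn_period //; apply: divn_batch_size_lt => //.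
  by apply: leq_ltn_trans xr; exact: leq_trunc_div.
rewrite (eq_bigr (fun l : 'I_i.+1 => (r ^ K)%:R * 2 ^+ l)) => [|l _]; last first.
  have lK : (l <= K)%N by have := ltn_ord l; lia.
  rewrite -mulr_suml -natr_sum -big_mkcond sum1_card card_b.
  by rewrite -(batch_size_mul r lK) !natrM !natrX exprMn; ring.
rewrite -mulr_sumr ler_wpM2l //.
by have := subrX1 (2 : R) i.+1; lra.
Qed.

Lemma top_fair_share i x k : (i <= K)%N -> (x < r ^ K)%N ->
  k \in batch n r K i (x %/ batch_size r K i) ->
  (2 * (batch_size r K i)%:R)^-1 <= fair_share tree_instance k (top_time r K i x).
Proof.
move=> iK xr kb; rewrite /fair_share /= {1}/tree_weight.
rewrite (batch_level r_gt0 iK _ kb) ?divn_batch_size_lt //.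
have s0 : 0 < (batch_size r K i)%:R :> R by rewrite ltr0n batch_size_gt0.
have w0 : 0 < (2 * r)%:R ^+ i :> R by rewrite exprn_gt0 // ltr0n muln_gt0.
have kt := fintype.subsetP (top_alive n r_gt0 iK xr) _ kb.
have W0 : 0 < \sum_(k in tree_alive n r K (top_time r K i x)) tree_weight k.
  rewrite (bigD1 k) //= ltr_pwDl ?tree_weight_gt0 //.
  by apply: sumr_ge0 => j _; exact/ltW/tree_weight_gt0.
rewrite ler_pdivlMr // mulrC ler_pdivrMr ?mulr_gt0 // mulrC.
exact: top_weight.
Qed.

Lemma half_batch_changes (c : R) (A : policy R n) x : 0 < c -> 4 * c < K.+1%:R ->
  nonnegative A -> feasible A -> approximate c A -> (x < r ^ K)%N ->
  exists2 i : 'I_K.+1, (i < K)%N &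
    (batch_size r K i <= 2 * #|[set k in batch n r K i (x %/ batch_size r K i) |
      A tree_instance k (leaf_time K x) != A tree_instance k (top_time r K i x)]|)%N.
Proof.
move=> c0 cK A0 Af Ac xr; set I := tree_instance; set T := leaf_time K x.
pose B (i : 'I_K.+1) := batch n r K i (x %/ batch_size r K i).
pose U (i : 'I_K.+1) := [set k in B i | A I k T != A I k (top_time r K i x)].
have lK (i : 'I_K.+1) : (i <= K)%N by rewrite -ltnS.
have [/existsP[i Ui]|/existsPn small] :=
  boolP [exists i : 'I_K.+1, batch_size r K i <= 2 * #|U i|]%N.
  (* At level [K] the top time is the leaf time, so nothing has changed there. *)
  exists i => //; rewrite ltn_neqAle lK andbT; apply: contraTneq Ui => iK.
  have top_leaf : top_time r K i x = T.
    by rewrite /top_time /T /leaf_time /batch_size iK subnS subnn expn0 divn1 muln1.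
  have -> : U i = finset.set0.
    by apply/setP => k; rewrite !inE top_leaf eqxx andbF.
  by rewrite cards0 muln0 -ltnNge batch_size_gt0.
(* More than half of the batch keeps its allocation from the top time, at least
   [(2 * batch_size r K i)^-1 / c] per job. *)
have big_batch (i : 'I_K.+1) : (4 * c)^-1 <= \sum_(k in B i) A I k T.
  have s0 : 0 < (batch_size r K i)%:R :> R by rewrite ltr0n batch_size_gt0.
  have BT := fintype.subsetP (leaf_alive n r_gt0 (lK i) xr).
  have cB : #|B i| = batch_size r K i by rewrite card_batch // divn_batch_size_lt.
  have UB : U i \subset B i by apply/fintype.subsetP => k; rewrite inE => /andP[].
  apply: (@le_trans _ _ (\sum_(k in B i :\: U i) (2 * (batch_size r K i)%:R)^-1 / c)).
    rewrite sumr_const cardsD (finset.setIidPr UB) cB.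
    have := small i; rewrite -ltnNge => Ui.
    have {Ui} : (batch_size r K i <= 2 * (batch_size r K i - #|U i|))%N by lia.
    rewrite -(ler_nat R) natrM => h.
    have -> : (4 * c)^-1 = (2 * (batch_size r K i)%:R)^-1 / c * ((batch_size r K i)%:R / 2).
      by field; rewrite !gt_eqF.
    rewrite -[leRHS]mulr_natr ler_wpM2l //; last by lra.
    by rewrite divr_ge0 ?invr_ge0 ?mulr_ge0 // ltW.
  rewrite [leRHS](finset.big_setID (U i)) /= (finset.setIidPr UB) ler_wpDl //.
    by apply: sumr_ge0 => k kU; apply: A0; apply: BT; exact: (fintype.subsetP UB).
  apply: ler_sum => k /finset.setDP[kB]; rewrite inE kB /= negbK => /eqP ->.
  apply: le_trans (Ac _ _ _ _); last exact: (fintype.subsetP (top_alive n r_gt0 (lK i) xr)).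
  by rewrite ler_pM2r ?invr_gt0 // top_fair_share.
have B_level (i : 'I_K.+1) k : k \in B i -> level r K k = i.
  by apply: batch_level => //; rewrite divn_batch_size_lt.
have disjB (i j : 'I_K.+1) k : k \in B i -> k \in B j -> i = j.
  by move=> /B_level ki /B_level kj; apply: val_inj; rewrite /= -kj ki.
(* The disjoint batches would hold at least [K.+1 / (4 * c) > 1] in total. *)
suff : 1 < (1 : R) by rewrite ltxx.
apply: lt_le_trans (Af I T).
apply: (@lt_le_trans _ _ (\sum_(i < K.+1) \sum_(k in B i) A I k T)).
  apply: lt_le_trans (ler_sum _ (fun i _ => big_batch i)).
  by rewrite sumr_const card_ord -[ltRHS]mulr_natl ltr_pdivlMr ?mulr_gt0 // mul1r.
rewrite (exchange_big_dep (mem (alive I T))) /= => [|i k _ kB]; last first.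
  exact: (fintype.subsetP (leaf_alive n r_gt0 (lK i) xr)).
apply: ler_sum => k kT.
have [/existsP[i ki]|/existsPn none] := boolP [exists i, k \in B i]; last first.
  rewrite big_pred0 ?A0 // => i; apply/negbTE/none.
rewrite (big_pred1 i) // => j; apply/idP/eqP => [kj|->//].
exact: disjB kj ki.
Qed.

(** * Charging disruptions to leaves *)

Definition level_disrupted (A : policy R n) (i t : nat) : {set 'I_n} :=
  [set k in disrupted A tree_instance t | level r K k == i].

(** The quotient by [period i.+1] is the same at both times, hence in between, where each changed
    job is disrupted. *)
Lemma changes_le_window_disruptions (A : policy R n) (i x : nat) :
  (i <= K)%N -> (x < r ^ K)%N ->
  (#|[set k in batch n r K i (x %/ batch_size r K i) |
      A tree_instance k (leaf_time K x) != A tree_instance k (top_time r K i x)]|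
   <= \sum_(t < r ^ K * K.+1 | t %/ period r K i.+1 == x %/ batch_size r K i.+1)
        #|level_disrupted A i t|)%N.
Proof.
move=> iK xr; pose P t := (t %/ period r K i.+1 == x %/ batch_size r K i.+1)%N.
apply: (@leq_trans (\sum_(k in [set k in _ | _])
  \sum_(t < r ^ K * K.+1 | P t) (k \in level_disrupted A i t))%N).
  rewrite -sum1_card; apply: leq_sum => k; rewrite inE => /andP[kB neq].
  have [u /andP[su ut] ku] := change_disrupted (I := tree_instance) (top_le_leaf _ _ iK)
    (fintype.subsetP (top_alive n r_gt0 iK xr) _ kB)
    (fintype.subsetP (leaf_alive n r_gt0 iK xr) _ kB) neq.
  have uN : (u < r ^ K * K.+1)%N by move: ut; rewrite /leaf_time; nia.
  have Pu : P u.
    rewrite /P eqn_leq; apply/andP; split.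
      by rewrite -(divn_period r i.+1 x (leqnn K)) leq_div2r.
    rewrite -[leqLHS](@mulnK _ (batch_size r K i.+1)) ?batch_size_gt0 //.
    by rewrite -(divn_period r i.+1 _ iK) leq_div2r // ltnW.
  rewrite (bigD1 (Ordinal uN)) //= inE ku (batch_level r_gt0 iK _ kB) ?eqxx //.
  exact: divn_batch_size_lt.
rewrite exchange_big leq_sum // => t _.
rewrite -big_mkcondr sum1_card; apply: subset_leq_card.
by apply/fintype.subsetP => k /andP[].
Qed.

Lemma sum_level_disrupted (A : policy R n) t :
  (\sum_(i < K.+1) #|level_disrupted A i t| <= #|disrupted A tree_instance t|)%N.
Proof.
under eq_bigr do rewrite -sum1_card big_mkcond.
rewrite exchange_big -[leqRHS]sum1_card [leqRHS]big_mkcond leq_sum // => k _ /=.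
rewrite -big_mkcond; case: ifP => kt; last by rewrite big_pred0 // => i; rewrite inE kt.
(* Above level [K], [inord] is a default value, but then no [i] qualifies. *)
rewrite sum1_card -(card1 (inord (level r K k) : 'I_K.+1)); apply: subset_leq_card.
apply/fintype.subsetP => i ki; move: (ki : k \in level_disrupted A i t).
by rewrite inE => /andP[_ /eqP lk]; rewrite inE lk inord_val.
Qed.

(** A disruption at time [t] is charged to these leaves in equal shares, which therefore add up to
    one. *)
Lemma card_window (i t : nat) : (t < r ^ K * K.+1)%N ->
  #|[set x : 'I_(r ^ K) | (x %/ batch_size r K i == t %/ period r K i)%N]| = batch_size r K i.
Proof.
move=> tN; apply: card_divn_eq; first exact: batch_size_gt0.
have /dvdnP[q rq] : (batch_size r K i %| r ^ K)%N by apply: dvdn_exp2l; lia.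
have d0 := batch_size_gt0 K r_gt0 i.
rewrite [leqRHS]rq leq_mul2r ltn_divLR ?period_gt0 // /period mulnCA -rq mulnC tN.
by rewrite orbT.
Qed.

Lemma tree_disruptions (c : R) (A : policy R n) : 0 < c -> 4 * c < K.+1%:R ->
  nonnegative A -> feasible A -> approximate c A ->
  (r ^ K.+1)%:R / 2 <= \sum_(0 <= t < r ^ K * K.+1) #|disrupted A tree_instance t|%:R :> R.
Proof.
move=> c0 cK A0 Af Ac; set N := (r ^ K * K.+1)%N.
pose d (i : nat) : R := (batch_size r K i.+1)%:R.
have d_gt0 i : 0 < d i by rewrite ltr0n batch_size_gt0.
pose P (x i t : nat) := (t %/ period r K i.+1 == x %/ batch_size r K i.+1)%N.
(* The share charged to the leaf x of the disruptions of level i. *)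
pose F (x i : nat) : R := \sum_(t < N | P x i t) #|level_disrupted A i t|%:R / d i.
have F_ge0 x i : 0 <= F x i by apply: sumr_ge0 => t _; rewrite divr_ge0 // ltW.
have leaf (x : 'I_(r ^ K)) : r%:R / 2 <= \sum_(i < K.+1) F x i.
  have [i iK half] := half_batch_changes c0 cK A0 Af Ac (ltn_ord x).
  rewrite (bigD1 i) //= ler_wpDr ?sumr_ge0 // /F -mulr_suml ler_pdivlMr //.
  have {half} := leq_trans half (leq_mul (leqnn 2)
    (changes_le_window_disruptions A (ltnW iK) (ltn_ord x))).
  rewrite -natr_sum -(ler_nat R) natrM.
  (* This uses [i < K]: at [K] truncation makes both sizes [1]. *)
  have -> : batch_size r K i = (batch_size r K i.+1 * r)%N.
    by rewrite /batch_size -expnSr subnSK.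
  rewrite natrM -/(d i) => h; lra.
have -> : (r ^ K.+1)%:R / 2 = \sum_(x < r ^ K) (r%:R / 2) :> R.
  by rewrite sumr_const card_ord -mulr_natr expnS natrM; ring.
apply: le_trans (ler_sum _ (fun x _ => leaf x)) _.
rewrite exchange_big /=.
apply: (@le_trans _ _ (\sum_(i < K.+1) \sum_(t < N) #|level_disrupted A i t|%:R)).
  apply: ler_sum => i _; rewrite /F (exchange_big_dep xpredT) //=.
  apply: ler_sum => t _; rewrite sumr_const.
  have -> : #|[pred x : 'I_(r ^ K) | P x i t]| = batch_size r K i.+1.
    by rewrite -(card_window i.+1 (ltn_ord t)); apply: eq_card => x; rewrite inE eq_sym.
  by rewrite -[leLHS]mulr_natr divfK // gt_eqF.
rewrite exchange_big /= big_mkord; apply: ler_sum => t _.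
by rewrite -natr_sum ler_nat sum_level_disrupted.
Qed.
End TreeInstance.

(** * Choice of the branching factor and the exponent *)

Lemma branching_factor (n K : nat) : (0 < K)%N -> (K.+1 <= n)%N ->
  exists r : nat, [/\ (0 < r)%N, (K.+1 * r ^ K <= n)%N & (n <= K.+1 * (2 * r) ^ K)%N].
Proof.
move=> K0 nK.
have ex : exists r : nat, (K.+1 * r ^ K <= n)%N by exists 1%N; rewrite exp1n muln1.
have bnd r : (K.+1 * r ^ K <= n)%N -> (r <= n)%N.
  case: r => // r; apply: leq_trans; rewrite -[leqLHS]mul1n leq_mul //.
  by rewrite -[leqLHS]expn1 leq_pexp2l.
(* The largest fitting [r] serves: [r.+1] does not fit, and [r.+1 <= 2 * r]. *)
case: (ex_maxnP ex bnd) => r rn rmax.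
have r0 : (0 < r)%N by apply: rmax; rewrite exp1n muln1.
exists r; split=> //; apply: (@leq_trans (K.+1 * r.+1 ^ K)).
  by rewrite ltnW // ltnNge; apply: contraTN (ltnSn r) => /rmax; rewrite -leqNgt.
rewrite leq_mul2l leq_exp2r //; apply/orP; right; lia.
Qed.

Lemma powR_branching_bound (R : realType) (a : R) (n r K : nat) :
  (0 < K)%N -> (0 < r)%N -> (0 < n)%N -> a <= K%:R^-1 -> (n <= K.+1 * (2 * r) ^ K)%N ->
  n%:R `^ (1 + a) <= K.+1%:R ^+ 2 * 2 ^+ K.+1 * (r ^ K.+1)%:R :> R.
Proof.
move=> K0 r0 n0 aK nr.
have n1 : 1 <= n%:R :> R by rewrite ler1n.
have KR : 0 < K%:R :> R by rewrite ltr0n.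
rewrite powRD; last by rewrite pnatr_eq0 -lt0n n0 implybT.
rewrite powRr1 //.
have root : n%:R `^ a <= K.+1%:R * (2 * r)%:R :> R.
  apply: le_trans (ler_powR n1 aK) _.
  (* Enlarging the factor [K.+1] to its [K]-th power makes the bound on [n] a perfect [K]-th
     power. *)
  apply: (@le_trans _ _ (((K.+1 * (2 * r))%:R ^+ K) `^ K%:R^-1)).
    apply: ge0_ler_powR; rewrite ?invr_ge0 ?nnegrE ?exprn_ge0 //.
    rewrite -natrX ler_nat expnMn; apply: leq_trans nr _.
    by rewrite leq_mul2r -[leqLHS]expn1 leq_pexp2l ?orbT.
  by rewrite -powR_mulrn // -powRrM divff ?gt_eqF // powRr1 // natrM.
have nrR : n%:R <= (K.+1 * (2 * r) ^ K)%:R :> R by rewrite ler_nat.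
apply: le_trans (ler_pM _ _ nrR root) _; rewrite ?powR_ge0 //.
rewrite le_eqVlt; apply/orP; left; apply/eqP.
by rewrite !natrM !natrX !natrM exprMn !exprS; ring.
Qed.

Theorem theorem1p3 (R : realType) (c : R) (hc : 1 <= c) :
  exists (kappa : R) (n0 : nat), 0 < kappa /\
    forall n : nat, (n0 <= n)%N ->
    forall A : policy R n,
      nonnegative A -> online A -> feasible A -> approximate c A ->
      exists I : instance R n,
        ((kappa * n%:R `^ (1 + 1 / (4 * c + 1)))%:E <= disruptions A I)%E.
Proof.
have c0 : 0 < c by lra.
(* [4 * c < K.+1] overloads the leaves, while [K <= 4 * c] gives [1 / (4 * c + 1) <= 1 / K]. *)
pose K := Num.trunc (4 * c).
have /andP[Kc cK] : K%:R <= 4 * c < K.+1%:R by apply: truncn_itv; lra.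
have K0 : (0 < K)%N by rewrite truncn_gt0; lra.
pose C : R := K.+1%:R ^+ 2 * 2 ^+ K.+1.
have C0 : 0 < C by rewrite mulr_gt0 ?exprn_gt0.
(* [C] is the factor in [powR_branching_bound] and [2] the half in [tree_disruptions]; [K.+1 <= n]
   lets [r = 1] fit. *)
exists (2 * C)^-1, K.+1; split; first by rewrite invr_gt0 mulr_gt0.
move=> n nK A A0 _ Af Ac.
have [r [r0 rn nr]] := branching_factor K0 nK.
exists (tree_instance R n K r0); apply: le_trans (ge_partial_disruptions _ _ _).
rewrite lee_fin; apply: le_trans (tree_disruptions r0 rn c0 cK A0 Af Ac).
have aK : 1 / (4 * c + 1) <= K%:R^-1.
  by rewrite div1r lef_pV2 ?posrE ?ltr0n //; lra.
have := powR_branching_bound K0 r0 (leq_trans (ltn0Sn K) nK) aK nr.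
rewrite -/C => h; rewrite mulrC ler_pdivrMr ?mulr_gt0 //.
by apply: le_trans h _; rewrite le_eqVlt; apply/orP; left; apply/eqP; field.
Qed.
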